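(* Let $L>0$ and let $\rho\in\mathbb{R}$ with $-\frac{1}{20L}\le \rho\le 0$. Let $F:\mathbb{R}^n\to\mathbb{R}^n$ be $L$-Lipschitz, let $A:\mathbb{R}^n\rightrightarrows\mathbb{R}^n$ be maximally monotone, suppose $F+A$ is $\rho$-comonotone, and let $z^*\in\mathbb{R}^n$ satisfy $0\in F(z^* )+A(z^* )$. Let $\eta=\frac{0.31}{L}$, let $z_0\in\mathbb{R}^n$, and let $\{z_k,z_{k+\frac12}\}_{k\ge1}$ and $\{c_k\}_{k\ge 1}$ be generated by the composite-EAG algorithm with step size $\eta$ started at $z_0$. Then for every integer $T\ge1$, $$ r^{tan}_{F,A}(z_T)^2\le \|F(z_T)+c_T\|^2\le\frac{20H^2}{\eta^2T^2},$$ where $H^2:=6\|z_1-z_0\|^2+\|z_0-z^*\|^2\le 6\eta^2 r^{tan}_{F,A}(z_0)^2+\|z_0-z^*\|^2$.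
   Context: $\mathbb{R}^n$ carries the Euclidean inner product $\langle\cdot,\cdot\rangle$ and norm $\|\cdot\|$. A set-valued operator $E:\mathbb{R}^n\rightrightarrows\mathbb{R}^n$ is $\rho$-comonotone if $\langle u-u',z-z'\rangle\ge\rho\|u-u'\|^2$ for all $z,z'$ and all $u\in E(z)$, $u'\in E(z')$; it is monotone if it is $0$-comonotone, and maximally monotone if it is monotone and its graph is not strictly contained in the graph of another monotone operator. $(F+A)(z)=\{F(z)+c: c\in A(z)\}$. The resolvent is $J_{\eta A}=(I+\eta A)^{-1}$, which for maximally monotone $A$ and $\eta>0$ is single-valued and defined on all of $\mathbb{R}^n$. The tangent residual is $r^{tan}_{F,A}(z)=\min_{c\in A(z)}\|F(z)+c\|$ (equal to $+\infty$ if $A(z)=\emptyset$). composite-EAG: given $z_0\in\mathbb{R}^n$ and $\eta>0$, put $\beta_k=\frac1{k+1}$, $z_1=J_{\eta A}[z_0-\eta F(z_0)]$, $c_1=\frac{z_0-\eta F(z_0)-z_1}{\eta}$, and for $k\ge1$ $$z_{k+\frac12}=\beta_kz_0+(1-\beta_k)z_k-\eta F(z_k)-\eta c_k,$$ $$z_{k+1}=J_{\eta A}[\beta_kz_0+(1-\beta_k)z_k-\eta F(z_{k+\frac12})],$$ $$c_{k+1}=\frac{\beta_kz_0+(1-\beta_k)z_k-\eta F(z_{k+\frac12})-z_{k+1}}{\eta}.$$ *)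

(* Defs.v *)
From HB Require Import structures.
From mathcomp Require Import all_boot all_order all_algebra.
From mathcomp Require Import all_classical all_reals all_analysis.
Set Implicit Arguments.
Unset Strict Implicit.
Unset Printing Implicit Defensive.
Import Order.TTheory GRing.Theory Num.Theory.
Import numFieldNormedType.Exports.
Local Open Scope classical_set_scope.
Local Open Scope ring_scope.

(* Vectors of R^n are rows 'rV[R]_n; a set-valued operator maps each vector to
   a set of vectors.  The norm `|_| that MathComp-Analysis puts on 'rV[R]_n is
   the sup norm, hence the Euclidean [enorm] below. *)

Definition edot (R : realType) (n : nat) (u v : 'rV[R]_n) : R :=
  \sum_(i < n) u 0 i * v 0 i.

Definition enorm (R : realType) (n : nat) (u : 'rV[R]_n) : R :=
  Num.sqrt (edot u u).

Definition elipschitz (R : realType) (n : nat) (L : R)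
    (F : 'rV[R]_n -> 'rV[R]_n) : Prop :=
  forall z z', enorm (F z - F z') <= L * enorm (z - z').

Definition setop (R : realType) (n : nat) := 'rV[R]_n -> set 'rV[R]_n.

Definition graph (R : realType) (n : nat) (E : setop R n) :
    set ('rV[R]_n * 'rV[R]_n) :=
  [set p | E p.1 p.2].

Definition comonotone (R : realType) (n : nat) (rho : R) (E : setop R n) :
    Prop :=
  forall z z' u u', E z u -> E z' u' ->
    edot (u - u') (z - z') >= rho * enorm (u - u') ^+ 2.

Definition monotone (R : realType) (n : nat) (E : setop R n) : Prop :=
  comonotone 0 E.

(* [`<`] is strict inclusion. *)
Definition maximally_monotone (R : realType) (n : nat) (A : setop R n) : Prop :=
  monotone A /\ ~ (exists B : setop R n, monotone B /\ graph A `<` graph B).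

Definition op_add (R : realType) (n : nat) (F : 'rV[R]_n -> 'rV[R]_n)
    (A : setop R n) : setop R n :=
  fun z => [set F z + c | c in A z].

Definition op_scale (R : realType) (n : nat) (eta : R) (A : setop R n) :
    setop R n :=
  fun z => [set eta *: c | c in A z].

Definition op_inv (R : realType) (n : nat) (E : setop R n) : setop R n :=
  fun u => [set z | E z u].

(* J_{eta A} = (I + eta A)^-1, kept set-valued: for maximally monotone A and
   eta > 0 each value is a singleton, so [resolvent eta A w z] says that
   z = J_{eta A}[w]. *)
Definition resolvent (R : realType) (n : nat) (eta : R) (A : setop R n) :
    setop R n :=
  op_inv (op_add id (op_scale eta A)).

(* The infimum is +oo when A z is empty; otherwise it is a minimum when A is
   maximally monotone, see [tangent_residual_min]. *)
Definition tangent_residual (R : realType) (n : nat)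
    (F : 'rV[R]_n -> 'rV[R]_n) (A : setop R n) (z : 'rV[R]_n) : \bar R :=
  ereal_inf [set (enorm (F z + c))%:E | c in A z].

Definition EAG_beta (R : realType) (k : nat) : R := k.+1%:R^-1.

(* [zh k] stands for z_{k+1/2}; only the indices k >= 1 of z, zh and c are
   constrained, the starting point being z0. *)
Definition composite_EAG (R : realType) (n : nat) (F : 'rV[R]_n -> 'rV[R]_n)
    (A : setop R n) (eta : R) (z0 : 'rV[R]_n) (z zh c : nat -> 'rV[R]_n) :
    Prop :=
  [/\ resolvent eta A (z0 - eta *: F z0) (z 1%N),
      c 1%N = eta^-1 *: (z0 - eta *: F z0 - z 1%N)
    & forall k, (1 <= k)%N ->
      let b := EAG_beta R k in
      [/\ zh k = b *: z0 + (1 - b) *: z k - eta *: F (z k) - eta *: c k,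
          resolvent eta A (b *: z0 + (1 - b) *: z k - eta *: F (zh k)) (z k.+1)
        & c k.+1 = eta^-1 *:
            (b *: z0 + (1 - b) *: z k - eta *: F (zh k) - z k.+1)]].

Lemma continuous_edot (R : realType) (n : nat) (T : topologicalType)
    (f g : T -> 'rV[R]_n) : (forall i, continuous (fun x => f x 0 i)) ->
  (forall i, continuous (fun x => g x 0 i)) ->
  continuous (fun x => edot (f x) (g x)).
Proof.
move=> cf cg x; rewrite /edot.
apply: cvg_big => [|i _]; first exact: add_continuous.
by apply: cvgM; [exact: cf|exact: cg].
Qed.

Lemma continuous_coord_addr (R : realType) (n : nat) (a : 'rV[R]_n) i :
  continuous (fun c : 'rV[R]_n => (a + c) 0 i).
Proof.
rewrite (_ : (fun c => _) = (fun c : 'rV[R]_n => a 0 i + c 0 i)); last first.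
  by apply/funext => c; rewrite mxE.
by move=> x; apply: continuousD; [exact: cst_continuous|exact: coord_continuous].
Qed.

Lemma maximally_monotoneP (R : realType) (n : nat) (A : setop R n) z c :
  maximally_monotone A ->
  (forall z' c', A z' c' -> 0 <= edot (c - c') (z - z')) -> A z c.
Proof.
move=> [mA maxA] zc; apply: contrapT => nAzc; apply: maxA.
exists (fun z' => [set c' | A z' c' \/ (z' = z /\ c' = c)]); split.
- move=> z1 z2 u1 u2 /= [A1|[-> ->]] [A2|[-> ->]]; rewrite mul0r.
  + by have := mA _ _ _ _ A1 A2; rewrite mul0r.
  + have := zc _ _ A1; congr (0 <= _); apply: eq_bigr => i _.
    by rewrite !mxE -mulrNN !opprB.
  + exact: zc.
  + by rewrite /edot sumr_ge0// => i _; rewrite !mxE !subrr mulr0.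
- split; first by move=> p Ap; left.
  by move=> /(_ (z, c)); apply: (contra_not _ nAzc); apply; right.
Qed.

Lemma maximally_monotone_closed (R : realType) (n : nat) (A : setop R n) z :
  maximally_monotone A -> closed (A z).
Proof.
move=> mA.
have -> : A z = \bigcap_(p in graph A)
    ((fun c : 'rV[R]_n => edot (- p.2 + c) (z - p.1)) @^-1` [set x | 0 <= x]).
  apply/seteqP; split=> c /=.
  - move=> Azc [z' c'] /= Ap.
    by have := mA.1 _ _ _ _ Azc Ap; rewrite mul0r [c - c']addrC.
  - move=> Ac; apply: maximally_monotoneP => // z' c' Ap.
    by rewrite [c - c']addrC; exact: (Ac (z', c') Ap).
apply: closed_bigI => p _.
have cp : continuous (fun c : 'rV[R]_n => edot (- p.2 + c) (z - p.1)).
  apply: continuous_edot => i; first exact: continuous_coord_addr.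
  by move=> x; exact: cst_continuous.
by apply: preimage_closed; [move=> x _; exact: cp|exact: closed_ge].
Qed.

Lemma tangent_residual_min (R : realType) (n : nat)
    (F : 'rV[R]_n -> 'rV[R]_n) (A : setop R n) (z : 'rV[R]_n) :
  maximally_monotone A -> A z !=set0 ->
  exists c, [/\ A z c, tangent_residual F A z = (enorm (F z + c))%:E
    & forall c', A z c' -> enorm (F z + c) <= enorm (F z + c')].
Proof.
move=> mA [c0 Ac0].
pose g (c : 'rV[R]_n) := edot (F z + c) (F z + c).
have cg : continuous g.
  by apply: continuous_edot => i; exact: continuous_coord_addr.
have cK : compact (A z `&` (g @^-1` [set x | x <= g c0])).
  apply: bounded_closed_compact; last first.
    apply: closedI; first exact: maximally_monotone_closed.
    by apply: preimage_closed; [move=> x _; exact: cg|exact: closed_le].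
  exists (Num.sqrt (g c0) + `|F z|); split; first exact: num_real.
  move=> M ltM c [_ /= gc]; apply: le_trans (ltW ltM).
  rewrite -[c](addKr (F z)) addrC (le_trans (ler_normB _ _))// lerD2r.
  rewrite [leLHS]mx_normrE.
  apply/bigmax_leP; split; first exact: sqrtr_ge0.
  move=> [i j] _ /=; rewrite (ord1 i) -sqrtr_sqr ler_wsqrtr//.
  apply: le_trans gc; rewrite /g /edot (bigD1 j)//= -expr2 lerDl.
  by apply: sumr_ge0 => k _; rewrite -expr2 sqr_ge0.
have K0 : A z `&` (g @^-1` [set x | x <= g c0]) !=set0.
  by exists c0; split => //=.
have [c /set_mem[Ac _] cmin] := compact_EVT_min K0 cK (continuous_subspaceT cg).
have minc c' : A z c' -> enorm (F z + c) <= enorm (F z + c').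
  move=> Ac'; rewrite /enorm ler_wsqrtr// -/(g c) -/(g c').
  have [le|/ltW gt] := leP (g c') (g c0); first by apply: cmin; rewrite inE.
  by apply: le_trans gt; apply: cmin; rewrite inE; split => //=.
exists c; split => //; apply/eqP; rewrite eq_le; apply/andP; split.
- by apply: ereal_inf_lbound; exists c.
- by apply: le_ereal_inf_tmp => _ [c' Ac' <-]; rewrite lee_fin minc.
Qed.

(* Main.v *)
Require Import Defs.
From HB Require Import structures.
From mathcomp Require Import all_boot all_order all_algebra.
From mathcomp Require Import all_classical all_reals all_analysis.
From mathcomp Require Import ring lra.
Import Order.TTheory GRing.Theory Num.Theory.
Import numFieldNormedType.Exports.
Local Open Scope classical_set_scope.
Local Open Scope ring_scope.
Set Implicit Arguments.
Unset Strict Implicit.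
Unset Printing Implicit Defensive.

(** Everything is measured in units of the step size.  Put
    [g_k = eta (F z_k + c_k)] and consider the anchored potential
      [V_k = k (k + 1) / 2 * |g_k|^2 + k <g_k, z_k - z0>].
    In these units [F] has Lipschitz constant 31/100 and [F + A] is
    (-5/31)-comonotone, because [rho / eta >= - 100 / (20 * 31)].

    The extrapolated point only enters through [h = eta (F z_{k+1/2} + c_{k+1})], for
    which [z_{k+1/2} - z_{k+1} = h - g_k]: the Lipschitz bound says that [h] is
    closer to [g_{k+1}] than to [g_k] by the factor 31/100.  An exact identity
    ([potential_difference]) writes [V_k - V_{k+1}] as [k (k + 1)] times a
    quantity that comonotonicity and this closeness make at least
    [5/4 |g_{k+1} - h|^2], plus the error [(k + 1) <g_{k+1}, h - g_{k+1}>].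
    Completing the square absorbs the error up to [(k + 1) / (5 k) |g_{k+1}|^2]
    ([potential_step]), so the potential is not monotone but nearly so.

    On the other side, comonotonicity between [z_k] and the solution bounds
    [V_k] below by [k^2 / 4 * |g_k|^2 + 21/62 k |g_k|^2 - |z0 - z*|^2]
    ([potential_lower_bound]).  The middle term swallows the error of the last
    step; if [|g_t|^2 <= 20 H^2 / t^2] for the earlier [t], the other errors add
    up to at most the telescoping sum of [4 H^2 / (t (t - 1))], that is [4 H^2],
    and [4 (H^2 + 4 H^2) = 20 H^2] closes the induction
    ([residual_rate]). *)

(** * Euclidean inner product *)

Section InnerProduct.
Context {R : realType} {n : nat}.
Implicit Types u v w : 'rV[R]_n.

Lemma edotC u v : edot u v = edot v u.
Proof. by apply: eq_bigr => i _; rewrite mulrC. Qed.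

Lemma edotDl u v w : edot (u + v) w = edot u w + edot v w.
Proof. by rewrite -big_split; apply: eq_bigr => i _; rewrite mxE mulrDl. Qed.

Lemma edotZl (a : R) u w : edot (a *: u) w = a * edot u w.
Proof. by rewrite mulr_sumr; apply: eq_bigr => i _; rewrite mxE mulrA. Qed.

Lemma edotNl u w : edot (- u) w = - edot u w.
Proof. by rewrite -scaleN1r edotZl mulN1r. Qed.

Lemma edotDr u v w : edot w (u + v) = edot w u + edot w v.
Proof. by rewrite !(edotC w) edotDl. Qed.

Lemma edotZr (a : R) u w : edot w (a *: u) = a * edot w u.
Proof. by rewrite !(edotC w) edotZl. Qed.

Lemma edotNr u w : edot w (- u) = - edot w u.
Proof. by rewrite !(edotC w) edotNl. Qed.

Definition edotE := (edotDl, edotDr, edotNl, edotNr, edotZl, edotZr).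

Lemma edot_ge0 u : 0 <= edot u u.
Proof. by apply: sumr_ge0 => i _; rewrite -expr2 sqr_ge0. Qed.

Lemma enorm_sqr u : enorm u ^+ 2 = edot u u.
Proof. by rewrite sqr_sqrtr// edot_ge0. Qed.

Lemma enormZ (a : R) u : enorm (a *: u) = `|a| * enorm u.
Proof.
by rewrite /enorm !edotE mulrA -expr2 sqrtrM ?sqr_ge0// sqrtr_sqr.
Qed.

End InnerProduct.

(** * The anchored potential *)

Section Potential.
Context {R : realType} {n : nat}.
Implicit Types a d h p q g w : 'rV[R]_n.

(** Here [g] stands for the scaled residual at the current iterate and [p] for
    the displacement of that iterate from the anchor [z0]. *)
Definition potential (k : R) g p : R :=
  k * (k + 1) / 2 * edot g g + k * edot g p.

(** The weights of the potential are chosen so that the terms containing the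
    anchor displacement [p] only occur in [edot (d - a) (q - p)], the quantity
    that comonotonicity controls. *)
Lemma potential_difference (k : R) a d h p q : 0 < k ->
  q = k / (k + 1) *: p - h ->
  potential k a p - potential (k + 1) d q =
  k * (k + 1) * (edot (d - a) (q - p) + edot (a - h) (a - h) / 2
                 - edot (d - h) (d - h) / 2)
  + (k + 1) * edot d (h - d).
Proof.
move=> k0 ->; rewrite /potential !edotE (edotC h a) (edotC h d).
by field; lra.
Qed.

(** The cross terms are dominated through
    [|d - a|^2 <= 3/2 |a - h|^2 + 3 |d - h|^2], an instance of Young's inequality
    weighted towards [|d - h|^2], which the second hypothesis makes about ten
    times smaller than [|a - h|^2]. *)
Lemma comonotone_gap_ge a d h w :
  - (5 / 31) * edot (d - a) (d - a) <= edot (d - a) w ->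
  edot (d - h) (d - h) <= (31 / 100) ^+ 2 * edot (a - h) (a - h) ->
  5 / 4 * edot (d - h) (d - h) <=
  edot (d - a) w + edot (a - h) (a - h) / 2 - edot (d - h) (d - h) / 2.
Proof.
set P := edot (a - h) (a - h); set Q := edot (d - h) (d - h) => com lip.
have P0 : 0 <= P by exact: edot_ge0.
have young : edot (d - a) (d - a) <= 3 / 2 * P + 3 * Q.
  have := edot_ge0 (2 *: (d - h) + (a - h)).
  rewrite /P /Q !edotE (edotC d a) (edotC h a) (edotC h d); lra.
lra.
Qed.

Lemma potential_step (k : R) a d h p q : 0 < k ->
  q = k / (k + 1) *: p - h ->
  - (5 / 31) * edot (d - a) (d - a) <= edot (d - a) (q - p) ->
  edot (d - h) (d - h) <= (31 / 100) ^+ 2 * edot (a - h) (a - h) ->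
  potential (k + 1) d q <= potential k a p + (k + 1) / (5 * k) * edot d d.
Proof.
move=> k0 qE com lip; rewrite -subr_ge0.
have gap := comonotone_gap_ge com lip.
have kk0 : 0 <= k * (k + 1) by rewrite mulr_ge0//; lra.
have := potential_difference a d k0 qE.
(* 5/2 k is the factor that completes the square of the error term. *)
have sq0 : 0 <= (k + 1) / (5 * k) *
    edot (d - (5 / 2 * k) *: (d - h)) (d - (5 / 2 * k) *: (d - h)).
  by rewrite mulr_ge0 ?edot_ge0// divr_ge0//; lra.
have sqE : (k + 1) / (5 * k) *
    edot (d - (5 / 2 * k) *: (d - h)) (d - (5 / 2 * k) *: (d - h)) =
    k * (k + 1) * (5 / 4 * edot (d - h) (d - h)) + (k + 1) * edot d (h - d)
    + (k + 1) / (5 * k) * edot d d.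
  by rewrite !edotE (edotC h d); field; lra.
have := ler_wpM2l kk0 gap; lra.
Qed.

(** Comonotonicity is used between the current iterate, at displacement [p], and
    a solution, at displacement [s], where the residual vanishes. *)
Lemma potential_lower_bound (k : R) g p s : 0 <= k ->
  - (5 / 31) * edot g g <= edot g (p - s) ->
  k ^+ 2 / 4 * edot g g + 21 / 62 * k * edot g g - edot s s <=
  potential k g p.
Proof.
move=> k0 com; have := edot_ge0 ((k / 2) *: g + s).
have := ler_wpM2l k0 com.
by rewrite /potential !edotE (edotC s g); lra.
Qed.

(** The joint induction: the bound on the potential at [T] gives the rate at
    [T + 1], and the rate at [T + 1] bounds the next increment of the potential
    by the telescoping term [4 H2 (1 / T - 1 / (T + 1))]. *)
Lemma residual_rate (g p : nat -> 'rV[R]_n) s (H2 : R) :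
  edot (g 1%N) (g 1%N) <= 20 * H2 ->
  edot s s + potential 1 (g 1%N) (p 1%N) <= H2 ->
  (forall k, (1 <= k)%N ->
     - (5 / 31) * edot (g k) (g k) <= edot (g k) (p k - s)) ->
  (forall k, (1 <= k)%N ->
     potential (k%:R + 1) (g k.+1) (p k.+1) <= potential k%:R (g k) (p k)
       + (k%:R + 1) / (5 * k%:R) * edot (g k.+1) (g k.+1)) ->
  forall T, (1 <= T)%N -> edot (g T) (g T) <= 20 * H2 / T%:R ^+ 2.
Proof.
move=> g1 V1 com step.
have H2_ge0 : 0 <= H2 by have := edot_ge0 (g 1%N); lra.
suff rate k : edot (g k.+1) (g k.+1) <= 20 * H2 / k.+1%:R ^+ 2 /\
    edot s s + potential k.+1%:R (g k.+1) (p k.+1) <=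
    H2 + 4 * H2 * (1 - k.+1%:R^-1) by case=> // k _; case: (rate k).
elim: k => [|k [_ IHV]].
  by rewrite expr1n divr1 invr1 subrr mulr0 addr0.
have t1 : 1 <= k.+1%:R :> R by rewrite ler1n.
have low := potential_lower_bound (ler0n R k.+2) (com k.+2 isT).
have up := step k.+1 isT.
move: low up IHV t1; rewrite -[k.+2]addn1 natrD addn1.
move: (k.+1%:R : R) => t; set x := edot (g _) _ => low up IHV t1.
have x0 : 0 <= x by exact: edot_ge0.
have tV : 0 < t^-1 by rewrite invr_gt0; lra.
have xle : x <= 20 * H2 / (t + 1) ^+ 2.
  rewrite ler_pdivlMr ?exprn_gt0//; last lra.
  (* The last error term fits under the linear term of the lower bound. *)
  have eat : (t + 1) / (5 * t) * x <= 21 / 62 * (t + 1) * x.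
    by rewrite ler_wpM2r// ler_pdivrMr; nra.
  have := mulr_ge0 H2_ge0 (ltW tV); lra.
split=> //; apply: le_trans (_ : _ <= H2 + 4 * H2 * (1 - t^-1)
    + (t + 1) / (5 * t) * (20 * H2 / (t + 1) ^+ 2)) _.
  have : (t + 1) / (5 * t) * x <= (t + 1) / (5 * t) * (20 * H2 / (t + 1) ^+ 2).
    by rewrite ler_wpM2l// divr_ge0; lra.
  lra.
by rewrite le_eqVlt; apply/orP; left; apply/eqP; field; lra.
Qed.

End Potential.

(** * Operators and resolvents *)

Section Operators.
Context {R : realType} {n : nat}.
Implicit Types (A : setop R n) (F : 'rV[R]_n -> 'rV[R]_n).

Lemma resolventP (eta : R) A w z : eta != 0 ->
  resolvent eta A w z -> A z (eta^-1 *: (w - z)).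
Proof.
by move=> eta0 [_ [c Ac <-] <-]; rewrite addrC addKr scalerA mulVf// scale1r.
Qed.

Lemma elipschitz_sqr (L : R) F z z' : elipschitz L F ->
  edot (F z - F z') (F z - F z') <= L ^+ 2 * edot (z - z') (z - z').
Proof.
move=> lip; rewrite -!enorm_sqr -exprMn lerXn2r// nnegrE; first exact: sqrtr_ge0.
by apply: le_trans (lip z z'); exact: sqrtr_ge0.
Qed.

Lemma comonotone_scale (eta rho r : R) (E : setop R n) z z' u u' :
  0 < eta -> r * eta <= rho -> comonotone rho E -> E z u -> E z' u' ->
  r * edot (eta *: u - eta *: u') (eta *: u - eta *: u') <=
  edot (eta *: u - eta *: u') (z - z').
Proof.
move=> eta0 rle com Eu Eu'; have := com _ _ _ _ Eu Eu'.
rewrite enorm_sqr -scalerBr !edotZl edotZr => le.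
rewrite mulrCA ler_pM2l// mulrA (le_trans _ le)//.
by rewrite ler_wpM2r// edot_ge0.
Qed.

Lemma tangent_residual_sqr_le F A z c : maximally_monotone A -> A z c ->
  (tangent_residual F A z ^+ 2 <= (enorm (F z + c) ^+ 2)%:E)%E.
Proof.
move=> mA Azc.
have [c' [_ -> le]] : exists c', [/\ A z c',
    tangent_residual F A z = (enorm (F z + c'))%:E
  & forall c'', A z c'' -> enorm (F z + c') <= enorm (F z + c'')].
  by apply: tangent_residual_min => //; exists c.
by rewrite -EFin_expe lee_fin lerXn2r ?nnegrE ?sqrtr_ge0// le.
Qed.

(** A forward-backward step is no longer than [eta] times any element of
    [F + A] at its starting point: the resolvent is nonexpansive, it maps
    [z0 - eta F z0] to [z1] and [z0 + eta c] to [z0], and these two arguments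
    differ by [eta (F z0 + c)]. *)
Lemma forward_backward_step_le (eta : R) F A z0 z1 c :
  0 < eta -> Defs.monotone A ->
  A z1 (eta^-1 *: (z0 - eta *: F z0 - z1)) -> A z0 c ->
  edot (z1 - z0) (z1 - z0) <= eta ^+ 2 * edot (F z0 + c) (F z0 + c).
Proof.
move=> eta0 mA Az1 Az0; have := mA _ _ _ _ Az1 Az0; rewrite mul0r.
set p := z1 - z0; set v := F z0 + c => mono.
have pv : edot p p <= - (eta * edot v p).
  move: mono; rewrite -(pmulr_rge0 _ eta0) -!edotZl [eta *: (_ - c)]scalerBr scalerA.
  rewrite mulfV ?gt_eqF// scale1r.
  have -> : z0 - eta *: F z0 - z1 - eta *: c = - p - eta *: v.
    by apply/rowP => i; rewrite !mxE; ring.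
  by rewrite !edotE; lra.
move: pv; clear mono; move: p v => p v pv.
by have := edot_ge0 (p + eta *: v); rewrite !edotE (edotC p v); lra.
Qed.

Lemma forward_backward_step_le_residual (eta : R) F A z0 z1 :
  0 < eta -> maximally_monotone A ->
  A z1 (eta^-1 *: (z0 - eta *: F z0 - z1)) ->
  ((enorm (z1 - z0) ^+ 2)%:E <=
   (eta ^+ 2)%:E * tangent_residual F A z0 ^+ 2)%E.
Proof.
move=> eta0 mA Az1.
have [[c Ac]|A0] := pselect (A z0 !=set0).
  have [c' [Ac' -> _]] := tangent_residual_min F mA (ex_intro _ c Ac).
  rewrite -EFin_expe -EFinM lee_fin !enorm_sqr.
  exact: (forward_backward_step_le eta0 mA.1 Az1 Ac').
rewrite /tangent_residual (_ : A z0 = set0) ?image_set0 ?ereal_inf0; last first.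
  by apply/seteqP; split=> // c Ac; apply: A0; exists c.
by rewrite expe2 mulyy gt0_muley ?lte_fin ?exprn_gt0// leey.
Qed.

End Operators.

(** * Convergence rate *)

Unset Implicit Arguments.
Set Strict Implicit.

Theorem theorem3p2 (R : realType) (n : nat) (L rho : R)
    (F : 'rV[R]_n -> 'rV[R]_n) (A : setop R n)
    (zstar z0 : 'rV[R]_n) (z zh c : nat -> 'rV[R]_n)
    (L_gt0 : 0 < L)
    (rho_ge : - (20 * L)^-1 <= rho) (rho_le0 : rho <= 0)
    (F_lip : elipschitz L F)
    (A_max : maximally_monotone A)
    (FA_comonotone : comonotone rho (op_add F A))
    (zstar_sol : op_add F A zstar 0)
    (eta := 31 / 100 / L : R)
    (alg : composite_EAG F A eta z0 z zh c)
    (H2 := 6 * enorm (z 1%N - z0) ^+ 2 + enorm (z0 - zstar) ^+ 2 : R) :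
  (forall T : nat, (1 <= T)%N ->
     (tangent_residual F A (z T) ^+ 2 <= (enorm (F (z T) + c T) ^+ 2)%:E)%E /\
     enorm (F (z T) + c T) ^+ 2 <= 20 * H2 / (eta ^+ 2 * T%:R ^+ 2)) /\
  (H2%:E <= (6 * eta ^+ 2)%:E * tangent_residual F A z0 ^+ 2
            + (enorm (z0 - zstar) ^+ 2)%:E)%E.
Proof.
have eta0 : 0 < eta by rewrite divr_gt0//; lra.
have etaN0 : eta != 0 by rewrite gt_eqF.
have etaL : eta * L = 31 / 100 by rewrite /eta divfK// gt_eqF.
have rhoE : - (5 / 31) * eta <= rho.
  rewrite (le_trans _ rho_ge)// le_eqVlt; apply/orP; left; apply/eqP.
  by rewrite /eta; field; rewrite gt_eqF.
clearbody eta; case: alg => res1 c1E algS.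
have Ac k : (1 <= k)%N -> A (z k) (c k).
  case: k => [//|[|k]] _; first by rewrite c1E; exact: resolventP.
  by have [_ ? ->] := algS k.+1 isT; exact: resolventP.
have Ac1 : A (z 1%N) (eta^-1 *: (z0 - eta *: F z0 - z 1%N)).
  exact: resolventP.
have lip x y : edot (eta *: F x - eta *: F y) (eta *: F x - eta *: F y) <=
    (31 / 100) ^+ 2 * edot (x - y) (x - y).
  rewrite -scalerBr edotZl edotZr mulrA -expr2 -etaL exprMn -[leRHS]mulrA.
  by rewrite ler_wpM2l ?sqr_ge0//; exact: elipschitz_sqr.
pose g k := eta *: (F (z k) + c k).
have Eg k : (1 <= k)%N -> op_add F A (z k) (F (z k) + c k).
  by move=> k1; exists (c k) => //; exact: Ac.
pose p k := z k - z0; pose s := zstar - z0.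
have pE : edot (p 1%N) (p 1%N) = enorm (z 1%N - z0) ^+ 2 by rewrite enorm_sqr.
have sE : edot s s = enorm (z0 - zstar) ^+ 2.
  by rewrite enorm_sqr /s -(opprB z0) edotNl edotNr opprK.
(* With [e] the scaled increment of [F] along the first step, the initial
   potential is [edot (e - p) e] with [p] that step, hence at most a multiple of
   [edot p p] by Lipschitzness. *)
have g1E : g 1%N = (eta *: F (z 1%N) - eta *: F z0) - p 1%N.
  rewrite /g c1E scalerDr scalerA mulfV// scale1r.
  by apply/rowP => i; rewrite !mxE; ring.
have lip1 := lip (z 1%N) z0.
have p0 := edot_ge0 (p 1%N); have s0 := edot_ge0 s.
have e0 := edot_ge0 (eta *: F (z 1%N) - eta *: F z0).
have ep0 := edot_ge0 (eta *: F (z 1%N) - eta *: F z0 + p 1%N).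
have rate : forall T, (1 <= T)%N -> edot (g T) (g T) <= 20 * H2 / T%:R ^+ 2.
  apply: (@residual_rate _ _ g p s).
  - move: lip1 p0 s0 e0 ep0; rewrite /H2 -pE -sE g1E -/(p 1%N).
    move: (p 1%N) (eta *: F (z 1%N) - eta *: F z0) => q e.
    by rewrite !edotE (edotC q e); lra.
  - move: lip1 p0 s0 e0 ep0; rewrite /H2 /potential -pE -sE g1E -/(p 1%N).
    move: (p 1%N) (eta *: F (z 1%N) - eta *: F z0) => q e.
    by rewrite !edotE (edotC q e); lra.
  - move=> k k1.
    have := comonotone_scale eta0 rhoE FA_comonotone (Eg k k1) zstar_sol.
    by rewrite scaler0 subr0 /p /s opprB addrA addrNK.
  - move=> k k1; have [zhE _ ckE] := algS k k1.
    have k0 : 0 < k%:R :> R by rewrite ltr0n.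
    have EAGE : 1 - EAG_beta R k = k%:R / (k%:R + 1).
      by rewrite /EAG_beta -natr1; field; lra.
    pose h := eta *: (F (zh k) + c k.+1).
    have zSE : z k.+1 =
        EAG_beta R k *: z0 + (1 - EAG_beta R k) *: z k - h.
      rewrite /h scalerDr ckE scalerA mulfV// scale1r.
      by apply/rowP => i; rewrite !mxE; ring.
    apply: (@potential_step _ _ _ _ _ h) => //.
    + by rewrite /p zSE -EAGE; apply/rowP => i; rewrite !mxE; ring.
    + have := comonotone_scale eta0 rhoE FA_comonotone (Eg k.+1 isT) (Eg k k1).
      by rewrite -/(g k) -/(g k.+1) /p opprB addrA addrNK.
    + have := lip (z k.+1) (zh k).
      have -> : z k.+1 - zh k = g k - h.
        by rewrite zSE zhE /g; apply/rowP => i; rewrite !mxE; ring.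
      suff -> : eta *: F (z k.+1) - eta *: F (zh k) = g k.+1 - h by [].
      by rewrite /g /h; apply/rowP => i; rewrite !mxE; ring.
split=> [T T1|].
  split; first by apply: tangent_residual_sqr_le => //; exact: Ac.
  have := rate T T1; rewrite -enorm_sqr enormZ exprMn gtr0_norm// => gT.
  rewrite [eta ^+ 2 * _]mulrC invfM mulrA ler_pdivlMr ?exprn_gt0//.
  by rewrite mulrC.
rewrite /H2 EFinD leeD2r// EFinM [(6 * _)%:E]EFinM -muleA lee_pmul2l//.
exact: forward_backward_step_le_residual.
Qed.
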